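(* Let $(Y,S)$ be a doubly minimal dynamical system and let $(X,T)$ be any minimal dynamical system. Then for every point $(y,x)\in Y\times X$, the orbit closure $\overline{\{(S^n y,T^n x): n\in\mathbb{Z}\}}$ of $(y,x)$ in the product system $(Y\times X,\,S\times T)$ is either all of $Y\times X$, or it is the graph $\Gamma_\pi=\{(\pi(z),z): z\in X\}$ of some factor map $\pi:X\to Y$.
   Context: A dynamical system is a pair $(X,T)$ where $X$ is a nonempty compact metric space and $T:X\to X$ is a homeomorphism. The orbit of a point $x$ is $\mathcal{O}_T(x)=\{T^n x: n\in\mathbb{Z}\}$, and its orbit closure is the closure $\overline{\mathcal{O}_T(x)}$. The system is minimal if every orbit is dense. A factor map $\pi:(X,T)\to(Y,S)$ is a continuous surjection $\pi:X\to Y$ with $\pi\circ T=S\circ\pi$. A minimal system $(Y,S)$ is called doubly minimal if the orbit closures of points of $Y\times Y$ under $S\times S$ are exactly the following sets: the graphs $\Gamma_m=\{(S^m y,y): y\in Y\}$, $m\in\mathbb{Z}$, and all of $Y\times Y$. In particular, $Y\times Y$ is itself the orbit closure of some point. *)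

(* Defs.v *)
From HB Require Import structures.
From mathcomp Require Import all_boot all_order all_algebra.
From mathcomp Require Import all_classical all_reals all_analysis.

Set Implicit Arguments.
Unset Strict Implicit.
Unset Printing Implicit Defensive.

Local Open Scope classical_set_scope.

Record homeo (X : topologicalType) := Homeo {
  homeo_fun :> X -> X ;
  homeo_inv : X -> X ;
  homeo_funK : cancel homeo_fun homeo_inv ;
  homeo_invK : cancel homeo_inv homeo_fun ;
  homeo_fun_cont : continuous homeo_fun ;
  homeo_inv_cont : continuous homeo_inv }.

(* T^n for n in Z; recall that Negz k is - (k + 1). *)
Definition homeo_pow (X : topologicalType) (T : homeo X) (n : int) (x : X) : X :=
  match n with
  | Posz k => iter k T x
  | Negz k => iter k.+1 (homeo_inv T) x
  end.

Section prod_homeo.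
Variables (Y X : topologicalType) (S : homeo Y) (T : homeo X).

Let prod_fun (p : Y * X) : Y * X := (S p.1, T p.2).
Let prod_inv (p : Y * X) : Y * X := (homeo_inv S p.1, homeo_inv T p.2).

Let prod_funK : cancel prod_fun prod_inv.
Proof. by case=> y x; rewrite /prod_inv /= !homeo_funK. Qed.

Let prod_invK : cancel prod_inv prod_fun.
Proof. by case=> y x; rewrite /prod_fun /= !homeo_invK. Qed.

Let prod_fun_cont : continuous prod_fun.
Proof.
move=> p; apply: cvg_pair => /=.
- by apply: continuous_comp; [exact: cvg_fst | exact: homeo_fun_cont].
- by apply: continuous_comp; [exact: cvg_snd | exact: homeo_fun_cont].
Qed.

Let prod_inv_cont : continuous prod_inv.
Proof.
move=> p; apply: cvg_pair => /=.
- by apply: continuous_comp; [exact: cvg_fst | exact: homeo_inv_cont].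
- by apply: continuous_comp; [exact: cvg_snd | exact: homeo_inv_cont].
Qed.

Definition prod_homeo : homeo (Y * X)%type :=
  Homeo prod_funK prod_invK prod_fun_cont prod_inv_cont.

Lemma homeo_pow_prod (n : int) (y : Y) (x : X) :
  homeo_pow prod_homeo n (y, x) = (homeo_pow S n y, homeo_pow T n x).
Proof.
by case: n => k; rewrite /homeo_pow; [|move: k.+1 => {}k]; elim: k => //= k ->.
Qed.

End prod_homeo.

Definition orbit (X : topologicalType) (T : homeo X) (x : X) : set X :=
  [set homeo_pow T n x | n in [set: int]].

Definition orbit_closure (X : topologicalType) (T : homeo X) (x : X) : set X :=
  closure (orbit T x).

Record dynSystem (R : realType) := DynSystem {
  dyn_space :> metricType R ;
  dyn_map : homeo dyn_space ;
  dyn_nonempty : [set: dyn_space] !=set0 ;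
  dyn_compact : compact [set: dyn_space] }.

Definition minimal (R : realType) (X : dynSystem R) : Prop :=
  forall x : X, dense (orbit (dyn_map X) x).

Definition factor_map (R : realType) (X Y : dynSystem R) (pi : X -> Y) : Prop :=
  [/\ continuous pi,
      set_surj [set: X] [set: Y] pi
    & pi \o dyn_map X = dyn_map Y \o pi].

(* The first coordinate is the value and the second one the argument. *)
Definition graph_of (X Y : Type) (f : X -> Y) : set (Y * X) :=
  [set (f z, z) | z in [set: X]].

Definition doubly_minimal (R : realType) (Y : dynSystem R) : Prop :=
  let S := dyn_map Y in
  minimal Y /\
  [set orbit_closure (prod_homeo S S) p | p in [set: (Y * Y)%type]] =
  [set graph_of (homeo_pow S m) | m in [set: int]] `|` [set [set: (Y * Y)%type]].

(* Main.v *)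
(* A minimal subset N of Y * X under S * T is either everything or a graph.
   Suppose that a fibre of N contains v <> w.  If v and w lie on different
   orbits, then (v, w) has dense orbit in Y * Y, so by compactness every pair
   (a, S^m a) lies in a common fibre, hence N meets its translate by S^m * 1
   and, by minimality, is invariant under it; the fibres are then all of Y.  If
   v = S^m w with m <> 0, then N is invariant under S^m * 1, so the union of
   the translates by S^i, 0 <= i < |m|, of one fibre is closed and S-invariant,
   hence is Y; as Y is not a single orbit, some fibre contains points of
   different orbits and the first case applies.

   Let M be the orbit closure of (y, x) and N in M a minimal set, say the graph
   of pi.  If y = S^m (pi x), then M lies in the graph of S^m \o pi, and so it is
   a graph.  Otherwise (y, pi x) has dense orbit in Y * Y, so for every k the
   set M meets, and hence contains, the graph of S^k \o pi; these graphs together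
   are dense in Y * X. *)

Require Import Defs.
From mathcomp Require Import all_boot all_order all_algebra.
From mathcomp Require Import all_classical all_reals all_analysis.

Set Implicit Arguments.
Unset Strict Implicit.
Unset Printing Implicit Defensive.

Import GRing.Theory.

Local Open Scope classical_set_scope.

(** * Topological preliminaries: equalizers and projections along a compact factor *)

Lemma continuous_pair (T U V : topologicalType) (f : T -> U) (g : T -> V) :
  continuous f -> continuous g -> continuous (fun x => (f x, g x)).
Proof. by move=> cf cg x; apply: cvg_pair; [exact: cf | exact: cg]. Qed.

Lemma continuous_fst (T U : topologicalType) : continuous (@fst T U).
Proof. by move=> x; exact: cvg_fst. Qed.

Lemma continuous_snd (T U : topologicalType) : continuous (@snd T U).
Proof. by move=> x; exact: cvg_snd. Qed.

Lemma continuous_compose (T U V : topologicalType) (f : T -> U) (g : U -> V) :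
  continuous f -> continuous g -> continuous (fun x => g (f x)).
Proof. by move=> cf cg x; apply: continuous_comp; [exact: cf | exact: cg]. Qed.

Lemma closed_equalizer (T U : topologicalType) (f g : T -> U) :
  hausdorff_space U -> continuous f -> continuous g ->
  closed [set x | f x = g x].
Proof.
move=> hU cf cg x clx; apply: hU => A B fA gB.
have nA : nbhs x (f @^-1` A) by exact: cf.
have nB : nbhs x (g @^-1` B) by exact: cg.
have [z [/= fgz [Az Bz]]] := clx _ (filterI nA nB).
by exists (f z); split=> //; rewrite fgz.
Qed.

(** Tube lemma: if [A] misses the slice over [w], compactness of [Z] makes it miss the slices over
    all points near [w]. *)
Lemma closed_projection (W Z : topologicalType) (A : set (W * Z)) :
  compact [set: Z] -> closed A -> closed [set w | exists z, A (w, z)].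
Proof.
move=> /compact_near_coveringP cZ clA.
rewrite -openC openE => w /= nAw.
suff: \forall w' \near w, [set: Z] `<=` (fun z' => ~ A (w', z')).
  by apply: filterS => w' w'A [z Az]; exact: (w'A z).
apply: cZ => z _.
have nbA : nbhs (w, z) (~` A).
  apply: open_nbhs_nbhs; split; first exact: closed_openC.
  by move=> /= Awz; apply: nAw; exists z.
case: nbA => -[U V] [/= nU nV] UV; exists (V, U) => //= -[z' w'] [/= Vz Uw].
exact: (UV (w', z')).
Qed.

(** * Integer powers of a homeomorphism *)

Section homeo_pow.
Variables (T : topologicalType) (f : homeo T).

Let homeo_powS n x : homeo_pow f (n + 1) x = f (homeo_pow f n x).
Proof.
case: n => [n|[|n]].
- by rewrite (_ : n%:Z + 1 = n.+1)%R // -addn1.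
- by rewrite /= homeo_invK.
- have -> : (Negz n.+1 + 1 = Negz n)%R.
    by rewrite !NegzE -[n.+2]addn1 PoszD opprD addrNK.
  by rewrite /= homeo_invK.
Qed.

Let homeo_powB n x : homeo_pow f (n - 1) x = homeo_inv f (homeo_pow f n x).
Proof. by rewrite -{2}[n](subrK 1%R) homeo_powS homeo_funK. Qed.

Lemma homeo_powD m n x :
  homeo_pow f (m + n) x = homeo_pow f m (homeo_pow f n x).
Proof.
elim: m => [|m IHm|m IHm]; first by rewrite add0r.
- by rewrite -addn1 PoszD addrAC !homeo_powS IHm.
- by rewrite -addn1 PoszD opprD addrAC !homeo_powB IHm.
Qed.

Lemma homeo_powK n : cancel (homeo_pow f n) (homeo_pow f (- n)).
Proof. by move=> x; rewrite -homeo_powD addNr. Qed.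

Lemma homeo_powCA m n x :
  homeo_pow f m (homeo_pow f n x) = homeo_pow f n (homeo_pow f m x).
Proof. by rewrite -!homeo_powD addrC. Qed.

Lemma continuous_homeo_pow n : continuous (homeo_pow f n).
Proof.
suff iterc (g : T -> T) k : continuous g -> continuous (iter k g).
  by case: n => n; apply: iterc; [exact: homeo_fun_cont|exact: homeo_inv_cont].
move=> cg; elim: k => [|k IHk]; first by move=> x.
exact: (continuous_compose IHk).
Qed.

End homeo_pow.

(** * Closed invariant sets and minimal sets *)

Section invariant_sets.
Variables (T : topologicalType) (f : homeo T).

Definition homeo_invariant (A : set T) :=
  forall n x, A x -> A (homeo_pow f n x).

Definition minimal_set (M : set T) :=
  [/\ closed M, homeo_invariant M, M !=set0 &
      forall C, closed C -> homeo_invariant C -> C !=set0 ->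
        C `<=` M -> M `<=` C].

Lemma orbit_closure_refl x : orbit_closure f x x.
Proof. by apply: subset_closure; exists 0%R. Qed.

Lemma closed_orbit_closure x : closed (orbit_closure f x).
Proof. exact: closed_closure. Qed.

Lemma invariant_orbit_closure x : homeo_invariant (orbit_closure f x).
Proof.
move=> n z clz B /(continuous_homeo_pow (n := n)) /clz [w [[m _ <-] Bw]].
by exists (homeo_pow f n (homeo_pow f m x)); split=> //; exists (n + m)%R;
  rewrite ?homeo_powD.
Qed.

Lemma orbit_closure_sub x (A : set T) :
  closed A -> homeo_invariant A -> A x -> orbit_closure f x `<=` A.
Proof.
move=> clA invA Ax; rewrite /orbit_closure.
rewrite (closure_id A).1//; apply: closureS => _ [n _ <-]; exact: invA.
Qed.

Lemma exists_minimal_set (A : set T) :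
  compact A -> closed A -> homeo_invariant A -> A !=set0 ->
  exists2 M, minimal_set M & M `<=` A.
Proof.
move=> cA clA invA A0.
(* Invariance concerns all integer powers, so it passes to complements. *)
have invC B : homeo_invariant B -> homeo_invariant (~` B).
  move=> invB n x nBx Bx; apply: nBx.
  by rewrite -(homeo_powK f n x); exact: invB.
(* Zorn's lemma on the open invariant sets that do not cover A; by compactness
   the union of a chain of such sets does not cover A either. *)
pose P U := [/\ open U, homeo_invariant U & ~ (A `<=` U)].
have [F FP Ftot|U [[oU invU nAU] maxU]] := @Zorn_bigcup T P.
  split.
  - by apply: bigcup_open => U /FP[].
  - by move=> n x [U FU Ux]; exists U => //; have [_ + _] := FP _ FU; apply.
  - move=> AF; have [a Aa] := A0; have [U0 FU0 _] := AF _ Aa.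
    (* The filter of tails of the chain: near-covering compactness merges the local covers of [A]
       into a single member of [F]. *)
    pose G := filter_from F (fun U => [set V | F V /\ U `<=` V]).
    have GF : Filter G.
      apply: filter_from_filter; first by exists U0.
      move=> U V FU FV; have [UV|VU] := Ftot _ _ FU FV.
        by exists V => // W [FW VW]; split; split=> //; exact: subset_trans VW.
      by exists U => // W [FW UW]; split; split=> //; exact: subset_trans UW.
    have /compact_near_coveringP covA := cA.
    suff [U FU UA] : \forall V \near G, A `<=` V.
      by have [_ _] := FP _ FU; apply; apply: UA; split.
    apply: covA => x Ax.
    have [U FU Ux] := AF _ Ax; have [oU _ _] := FP _ FU.
    exists (U, [set V | F V /\ U `<=` V]); last first.
      by move=> [y V] /= [Uy [_ UV]]; exact: UV.
    split=> /=; first exact: open_nbhs_nbhs.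
    by exists U.
exists (A `\` U); last by move=> x [].
split.
- by apply: closedI => //; exact: open_closedC.
- by move=> n x [Ax nUx]; split; [exact: invA | exact: invC].
- by have /existsNP[x /not_implyP[Ax nUx]] := nAU; exists x.
move=> C clC invC' [c Cc] CAU x [Ax nUx].
(* If [C] missed [x], its complement would strictly enlarge [U] and still fail to cover [A]. *)
apply: contrapT => nCx; apply: (maxU (~` C)).
  split; first by move=> y Uy Cy; have [_] := CAU _ Cy.
  by move=> /(_ x nCx).
split; [exact: closed_openC | exact: invC |].
by move=> /(_ c); case: (CAU _ Cc) => Ac _ /(_ Ac).
Qed.

End invariant_sets.

(** An orbit starting in [A] stays there, yet by density it would enter the open complement of [A]
    if that were nonempty. *)
Lemma minimal_mem (R : realType) (X : dynSystem R) (A : set X) x :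
  minimal X -> closed A -> homeo_invariant (dyn_map X) A -> A !=set0 -> A x.
Proof.
move=> mX clA invA [a Aa]; apply: contrapT => nAx.
have [|z [nAz [n _ nz]]] := mX a (~` A) _ (closed_openC clA); first by exists x.
by apply: nAz; rewrite -nz; exact: invA.
Qed.

(** * Consequences of double minimality *)

Section doubly_minimal.
Variables (R : realType) (Y : dynSystem R) (hY : doubly_minimal Y).
Let S := dyn_map Y.

Lemma doubly_minimal_dense u v : (forall m, u <> homeo_pow S m v) ->
  orbit_closure (prod_homeo S S) (u, v) = setT.
Proof.
move=> uv; have [_ dm] := hY.
have : [set orbit_closure (prod_homeo S S) p | p in [set: (Y * Y)%type]]
  (orbit_closure (prod_homeo S S) (u, v)) by exists (u, v).
rewrite dm => -[[m _ Em]|//]; exfalso.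
have : graph_of (homeo_pow S m) (u, v).
  by rewrite Em; exact: orbit_closure_refl.
by move=> [z _ [zu zv]]; apply: (uv m); rewrite -zu -zv.
Qed.

(** Some pair [(p, q)] has dense orbit. If [Y] were a single orbit, this pair would lie on the graph
    of a power of [S]; that graph is closed and invariant, so it would be all of [Y * Y], which two
    distinct points rule out. *)
Lemma exists_off_orbit v (u1 u2 : Y) : u1 <> u2 ->
  exists w, forall m, w <> homeo_pow S m v.
Proof.
move=> u12; apply/not_existsP => allv; apply: u12.
have orb w : exists m, w = homeo_pow S m v.
  apply: contrapT => nw; apply: (allv w) => m wm.
  by apply: nw; exists m.
have [_ dm] := hY.
have : ([set graph_of (homeo_pow S m) | m in [set: int]] `|`
  [set [set: (Y * Y)%type]]) [set: (Y * Y)%type] by right.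
rewrite -dm => -[[p q] _ pqT].
have [[a pa] [b qb]] := (orb p, orb q).
have pq : p = homeo_pow S (a - b) q by rewrite pa qb -homeo_powD subrK.
pose G := [set t : Y * Y | t.1 = homeo_pow S (a - b) t.2].
have GT : orbit_closure (prod_homeo S S) (p, q) `<=` G.
  apply: orbit_closure_sub => //.
  - apply: closed_equalizer; first exact: metric_hausdorff.
      exact: continuous_fst.
    apply: continuous_compose (@continuous_homeo_pow _ _ _).
    exact: continuous_snd.
  - move=> n [s t]; rewrite homeo_pow_prod /G /= => ->.
    exact: homeo_powCA.
rewrite pqT in GT.
exact: etrans (GT (u1, u1) I) (esym (GT (u2, u1) I)).
Qed.

End doubly_minimal.

(** * Closed invariant subsets of [Y * X] *)

Section joining.
Variables (R : realType) (Y X : dynSystem R).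
Let S := dyn_map Y.
Let T := dyn_map X.
Let ST := prod_homeo S T.

(** The projection of [M] to [X] is invariant, and closed because [Y] is compact. *)
Lemma joining_fibre_neq0 (M : set (Y * X)) :
  minimal X -> closed M -> homeo_invariant ST M -> M !=set0 ->
  forall z, exists v, M (v, z).
Proof.
move=> mX clM invM [[v0 z0] M0] z.
apply: (minimal_mem (A := [set z | exists v, M (v, z)])) => //; last by
  exists z0; exists v0.
  (* The coordinates are swapped because [closed_projection] eliminates the second one. *)
  apply: (@closed_projection _ _ [set p : X * Y | M (p.2, p.1)]).
    exact: dyn_compact.
  apply: (continuous_closedP (fun p : X * Y => (p.2, p.1))).1 clM.
  exact: continuous_pair (@continuous_snd _ _) (@continuous_fst _ _).
move=> n t [v Mvt]; exists (homeo_pow S n v).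
by rewrite -homeo_pow_prod; exact: invM.
Qed.

Lemma closed_fibre (M : set (Y * X)) z : closed M -> closed [set v | M (v, z)].
Proof.
move=> clM; apply: (continuous_closedP (fun v : Y => (v, z))).1 clM.
by apply: continuous_pair => ?; [exact: cvg_id | exact: cvg_cst].
Qed.

(** Each fibre is closed and contains a whole orbit of [S], which is dense. *)
Lemma joining_setT (M : set (Y * X)) :
  minimal Y -> closed M ->
  (forall z, exists v, forall m, M (homeo_pow S m v, z)) -> M = setT.
Proof.
move=> mY clM shM; apply/seteqP; split=> // -[a z] _; have [v Mv] := shM z.
have sub : orbit_closure S v `<=` [set b | M (b, z)].
  rewrite (closure_id [set b | M (b, z)]).1; last exact: closed_fibre.
  by apply: closureS => _ [m _ <-]; exact: Mv.
apply: sub; apply: minimal_mem => //; first exact: closed_orbit_closure.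
  exact: invariant_orbit_closure.
by exists v; exact: orbit_closure_refl.
Qed.

(** Continuity of [pi] is the closed graph theorem for compact [Y]; surjectivity comes from
    minimality of [Y], equivariance from invariance of [M]. *)
Lemma joining_graph (M : set (Y * X)) :
  minimal Y -> minimal X -> closed M -> homeo_invariant ST M -> M !=set0 ->
  (forall z v w, M (v, z) -> M (w, z) -> v = w) ->
  exists2 pi : X -> Y, factor_map pi & M = graph_of pi.
Proof.
move=> mY mX clM invM [[v0 z0] M0] funM.
have fullX := joining_fibre_neq0 mX clM invM (ex_intro _ (v0, z0) M0).
have fullY v : exists z, M (v, z).
  apply: (minimal_mem (A := [set v | exists z, M (v, z)])) => //; last by
    exists v0; exists z0.
    by apply: closed_projection clM; exact: dyn_compact.
  move=> n t [z Mtz]; exists (homeo_pow T n z).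
  by rewrite -homeo_pow_prod; exact: invM.
have [pi Mpi] := choice fullX.
exists pi; last first.
  apply/seteqP; split=> [[v z] Mvz|_ [z _ <-]//].
  by exists z => //; rewrite (funM _ _ _ Mvz (Mpi z)).
split.
- apply/continuous_closedP => C clC.
  have -> : pi @^-1` C = [set z | exists v, M (v, z) /\ C v].
    apply/seteqP; split=> z /=; first by exists (pi z).
    by move=> [v [Mvz Cv]]; rewrite (funM _ _ _ (Mpi z) Mvz).
  apply: (@closed_projection _ _ [set p : X * Y | M (p.2, p.1) /\ C p.2]).
    exact: dyn_compact.
  apply: closedI.
    apply: (continuous_closedP (fun p : X * Y => (p.2, p.1))).1 clM.
    exact: continuous_pair (@continuous_snd _ _) (@continuous_fst _ _).
  by apply: (continuous_closedP (@snd X Y)).1 clC; exact: continuous_snd.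
- move=> v _; have [z Mvz] := fullY v.
  by exists z => //; exact: funM (Mpi z) Mvz.
- apply/funext => z /=; apply: funM (Mpi _) _.
  have := invM 1%R _ (Mpi z).
  by rewrite homeo_pow_prod.
Qed.

(** The shift by S^m in the first coordinate commutes with [ST], so the points of [M] that it keeps
    in [M] form a nonempty closed invariant set. *)
Lemma minimal_set_shift (M : set (Y * X)) m v z :
  minimal_set ST M -> M (v, z) -> M (homeo_pow S m v, z) ->
  forall w t, M (w, t) -> M (homeo_pow S m w, t).
Proof.
move=> [clM invM _ minM] Mvz Mmvz w t Mwt.
have sub : M `<=` [set p | M p /\ M (homeo_pow S m p.1, p.2)]; last first.
  by have [] := sub _ Mwt.
apply: minM; last by move=> p [].
- apply: closedI => //.
  apply: (continuous_closedP
    (fun p : Y * X => (homeo_pow S m p.1, p.2))).1 clM.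
  apply: continuous_pair; last exact: continuous_snd.
  exact: continuous_compose (@continuous_fst _ _) (@continuous_homeo_pow _ _ _).
- move=> n [a b] [Mab Mmab]; split; first exact: invM.
  rewrite homeo_pow_prod /= homeo_powCA.
  by have := invM n _ Mmab; rewrite homeo_pow_prod.
- by exists (v, z).
Qed.

Lemma minimal_set_off_orbit (M : set (Y * X)) z v w :
  doubly_minimal Y -> minimal_set ST M ->
  (forall m, v <> homeo_pow S m w) -> M (v, z) -> M (w, z) ->
  forall a t m, M (a, t) -> M (homeo_pow S m a, t).
Proof.
move=> dY mM vw Mvz Mwz a t m Mat; have [clM invM _ _] := mM.
(* The pairs that share a fibre of [M]. *)
pose Q := [set p : Y * Y | exists z, M (p.1, z) /\ M (p.2, z)].
have clQ : closed Q.
  apply: (@closed_projection _ _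
    [set q : Y * Y * X | M (q.1.1, q.2) /\ M (q.1.2, q.2)]).
    exact: dyn_compact.
  apply: closedI.
    apply: (continuous_closedP (fun q : Y * Y * X => (q.1.1, q.2))).1 clM.
    apply: continuous_pair; last exact: continuous_snd.
    exact: continuous_compose (@continuous_fst _ _) (@continuous_fst _ _).
  apply: (continuous_closedP (fun q : Y * Y * X => (q.1.2, q.2))).1 clM.
  apply: continuous_pair; last exact: continuous_snd.
  exact: continuous_compose (@continuous_fst _ _) (@continuous_snd _ _).
have invQ : homeo_invariant (prod_homeo S S) Q.
  move=> n [b c] [s [Mb Mc]]; exists (homeo_pow T n s).
  rewrite homeo_pow_prod /= -!homeo_pow_prod.
  by split; exact: invM.
have QT : setT `<=` Q.
  rewrite -(doubly_minimal_dense dY vw).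
  by apply: orbit_closure_sub => //; exists z.
have [s [Mas Mmas]] := QT (a, homeo_pow S m a) I.
exact: minimal_set_shift mM Mas Mmas _ _ Mat.
Qed.

Lemma minimal_set_dichotomy (M : set (Y * X)) :
  doubly_minimal Y -> minimal X -> minimal_set ST M ->
  M = setT \/ exists2 pi : X -> Y, factor_map pi & M = graph_of pi.
Proof.
move=> dY mX mM; have [mY _] := dY; have [clM invM M0 _] := mM.
have [?|] := pselect (forall z v w, M (v, z) -> M (w, z) -> v = w).
  by right; exact: joining_graph.
move=> /existsNP[z /existsNP[v /existsNP[w /not_implyP[Mvz]]]].
move=> /not_implyP[Mwz vw].
left.
have off c a b : M (a, c) -> M (b, c) -> (forall m, a <> homeo_pow S m b) ->
    M = setT.
  move=> Mac Mbc ab.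
  apply: joining_setT => // t.
  have [d Mdt] := joining_fibre_neq0 mX clM invM M0 t.
  by exists d => m; exact: (minimal_set_off_orbit dY mM ab Mac Mbc).
have [vw'|/existsNP[m /contrapT vm]] :=
  pselect (forall m, v <> homeo_pow S m w); first exact: off Mvz Mwz vw'.
have m0 : m != 0%R by apply/eqP => m0; apply: vw; rewrite vm m0.
have shm a t : M (a, t) -> M (homeo_pow S m a, t).
  by apply: (minimal_set_shift mM Mwz); rewrite -vm.
(* The same two points read backwards: S^(-m) takes [v] to [w]. *)
have shNm a t : M (a, t) -> M (homeo_pow S (- m) a, t).
  by apply: (minimal_set_shift mM Mvz); rewrite vm homeo_powK.
have shqm q a : M (a, z) -> M (homeo_pow S (q * m) a, z).
  move=> Maz; elim: q => [|q IHq|q IHq]; first by rewrite mul0r.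
    by rewrite intS mulrDl mul1r homeo_powD; exact: shm.
  by rewrite intS opprD mulrDl mulN1r homeo_powD; exact: shNm.
pose U := [set b | exists i, M (homeo_pow S i b, z)].
(* The fibre over [z] is stable under shifts by multiples of [m], so only the residue of [i] modulo
   [m] matters, and a finite union of closed sets is closed. *)
have UE : U = \bigcup_(i in `I_`|m|) [set b | M (homeo_pow S i b, z)].
  apply/seteqP; split=> b /=; last by move=> [i _ ?]; exists i.
  move=> [i Mib]; exists (absz (modz i m)).
    by rewrite /= -ltz_nat gez0_abs ?modz_ge0 // ltz_mod.
  suff : M (homeo_pow S (absz (modz i m)) b, z) by [].
  rewrite gez0_abs ?modz_ge0 // /modz addrC -mulNr homeo_powD.
  exact: shqm.
have UT b : U b.
  apply: minimal_mem => //; last by exists v; exists 0%R.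
    rewrite UE; apply: closed_bigcup => [|i _]; first exact: finite_II.
    apply: (continuous_closedP (homeo_pow S i)).1 (closed_fibre clM).
    exact: continuous_homeo_pow.
  move=> n a [i Mia]; exists (i - n)%R.
  by rewrite -homeo_powD subrK.
(* Since [b] avoids the orbit of [v], so does its translate lying in the fibre over [z]; that fibre
   also contains [v]. *)
have [b wb] := exists_off_orbit dY v vw.
have [i Mib] := UT b.
apply: off Mib Mvz _ => k bv; apply: (wb (k - i)%R).
by rewrite addrC homeo_powD -bv homeo_powK.
Qed.

End joining.

Theorem theorem0p3 (R : realType) (Y X : dynSystem R)
    (hY : doubly_minimal Y) (hX : minimal X) (y : Y) (x : X) :
  orbit_closure (prod_homeo (dyn_map Y) (dyn_map X)) (y, x) =
    [set: (Y * X)%type] \/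
  exists2 pi : X -> Y, factor_map pi &
    orbit_closure (prod_homeo (dyn_map Y) (dyn_map X)) (y, x) = graph_of pi.
Proof.
set S := dyn_map Y; set T := dyn_map X; set ST := prod_homeo S T.
have [mY _] := hY.
set M := orbit_closure ST (y, x).
have clM : closed M by exact: closed_orbit_closure.
have invM : homeo_invariant ST M by exact: invariant_orbit_closure.
have Myx : M (y, x) by exact: orbit_closure_refl.
have M0 : M !=set0 by exists (y, x).
have [N mN NM] : exists2 N, minimal_set ST N & N `<=` M.
  apply: exists_minimal_set => //.
  apply: (subclosed_compact clM _ (@subsetT _ M)).
  by rewrite -setXTT; apply: compact_setX; exact: dyn_compact.
have [NT|[pi [cpi _ _] Npi]] := minimal_set_dichotomy hY hX mN.
  by left; apply/seteqP; split=> // p _; apply: NM; rewrite NT.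
have piT n z : pi (homeo_pow T n z) = homeo_pow S n (pi z).
  have [_ invN _ _] := mN.
  have : N (homeo_pow ST n (pi z, z)) by apply: invN; rewrite Npi; exists z.
  by rewrite homeo_pow_prod Npi => -[t _ [tz <-]]; rewrite -tz.
have [ynx|/existsNP[m /contrapT ym]] :=
  pselect (forall m, y <> homeo_pow S m (pi x)); last first.
  right; apply: joining_graph => //.
  have Mm : M `<=` [set p | p.1 = homeo_pow S m (pi p.2)].
    apply: orbit_closure_sub => //.
      apply: closed_equalizer; first exact: metric_hausdorff.
        exact: continuous_fst.
      apply: continuous_compose (@continuous_homeo_pow _ _ _).
      exact: continuous_compose (@continuous_snd _ _) cpi.
    move=> n [v z] /= ->; rewrite homeo_pow_prod /= piT.
    exact: homeo_powCA.
  by move=> z v w /Mm /= -> /Mm.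
left.
(* The image of [M] under the product of the identity and [pi]; it is closed since [X] is compact,
   and it contains [(y, pi x)]. *)
pose Q := [set p : Y * Y | exists z, M (p.1, z) /\ pi z = p.2].
have QT : setT `<=` Q.
  rewrite -(doubly_minimal_dense hY ynx); apply: orbit_closure_sub.
  - apply: (@closed_projection _ _
      [set q : Y * Y * X | M (q.1.1, q.2) /\ pi q.2 = q.1.2]).
      exact: dyn_compact.
    apply: closedI.
      apply: (continuous_closedP (fun q : Y * Y * X => (q.1.1, q.2))).1 clM.
      apply: continuous_pair; last exact: continuous_snd.
      exact: continuous_compose (@continuous_fst _ _) (@continuous_fst _ _).
    apply: closed_equalizer; first exact: metric_hausdorff.
      exact: continuous_compose (@continuous_snd _ _) cpi.
    exact: continuous_compose (@continuous_fst _ _) (@continuous_snd _ _).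
  - move=> n [a b] [z [Maz piz]]; exists (homeo_pow T n z).
    rewrite homeo_pow_prod /= piT piz -homeo_pow_prod.
    by split=> //; exact: invM.
  - by exists x.
have Mk k z : M (homeo_pow S k (pi z), z).
  apply: (minimal_mem (A := [set z | M (homeo_pow S k (pi z), z)])) => //.
  - apply: (continuous_closedP (fun z => (homeo_pow S k (pi z), z))).1 clM.
    apply: continuous_pair; last by move=> ?; exact: cvg_id.
    exact: continuous_compose cpi (@continuous_homeo_pow _ _ _).
  - move=> n t /(invM n); rewrite homeo_pow_prod homeo_powCA.
    by rewrite /= piT.
  (* Any pair on the graph of S^k would do here: its preimage in [M] lies on the graph of S^k
     composed with [pi]. *)
  - have [z0 [Mz piz]] := QT (homeo_pow S k y, y) I.
    by exists z0; rewrite /= piz.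
by apply: joining_setT => // z; exists (pi z) => m; exact: Mk.
Qed.
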